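(* Let $T_\lambda$ be a tree of diameter $\lambda$ and $C_\mu$ the cycle of length $\mu$, and suppose either $\lambda\ge 2$ and $\mu\ge 4$, or $\lambda=\mu=3$. Let $n=|V(T_\lambda\times C_\mu)|$. Then $(T_\lambda\times C_\mu)(s_1,\dots,s_n)\in\mathscr{C}_0$ for all integers $s_1,\dots,s_n\ge 2$.
   Context: $d(\cdot)$ denotes diameter. For a graph $G$ with vertex set $\{v_1,\dots,v_n\}$ and positive integers $s_1,\dots,s_n$, the vertex-multiplication $G(s_1,\dots,s_n)$ is the graph whose vertex set is a disjoint union $V_1\cup\dots\cup V_n$ with $|V_i|=s_i$, where $u\in V_i$ and $v\in V_j$ are adjacent iff $i\ne j$ and $v_iv_j\in E(G)$. For a connected bridgeless graph $X$, $\bar d(X)$ is the minimum diameter of a strong orientation of $X$. $\mathscr{C}_0$ is the class of all vertex-multiplications $G(s_1,\dots,s_n)$ of a connected graph $G$ with all $s_i\ge 2$ such that $\bar d(G(s_1,\dots,s_n))=d(G)$. The cartesian product $G\times H$ has vertex set $\{\langle u,x\rangle\}$, with $\langle u,x\rangle\langle v,y\rangle$ an edge iff either $u=v$ and $xy\in E(H)$, or $uv\in E(G)$ and $x=y$. *)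

(* Defs.v *)
From mathcomp Require Import all_boot.

Set Implicit Arguments.
Unset Strict Implicit.
Unset Printing Implicit Defensive.

Section Digraph.
Variable T : finType.
Implicit Types (e D : rel T) (x y : T) (k : nat).

Definition walk e k x y : bool :=
  [exists p : k.-tuple T, path e x p && (last x p == y)].

(* Least length of a walk from x to y.  A shortest walk repeats no vertex, so
   it is enough to search lengths below #|T|; the result is #|T| when y cannot
   be reached from x. *)
Definition dist e x y : nat := find (fun k => walk e k x y) (iota 0 #|T|).

(* Meaningful only when [strong e] holds. *)
Definition diam e : nat := \max_(x : T) \max_(y : T) dist e x y.

(* Strong connectivity; for a symmetric relation this is connectedness. *)
Definition strong e : bool := (0 < #|T|) && [forall x, forall y, connect e x y].

Definition orientation e D : bool :=
  [forall x, forall y, if e x y then D x y (+) D y x else ~~ D x y].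

Definition remove_edge e x y : rel T :=
  [rel u v | e u v && ((u, v) \notin [:: (x, y); (y, x)])].

Definition arcs (A : {set T * T}) : rel T := [rel x y | (x, y) \in A].

End Digraph.

Record sgraph := SGraph {
  vertex :> finType;
  edge : rel vertex;
  edge_sym : symmetric edge;
  edge_irr : irreflexive edge }.

Definition connected (G : sgraph) : bool := strong (@edge G).

Definition bridgeless (G : sgraph) : Prop :=
  forall x y : G, edge x y -> strong (remove_edge (@edge G) x y).

Definition gdiam (G : sgraph) : nat := diam (@edge G).

Definition tree (G : sgraph) : Prop :=
  connected G /\ (forall p : seq G, 2 < size p -> ~ ucycle (@edge G) p).

(* The initial value #|G| exceeds the diameter of every strong orientation, so
   it is the result only if there is none, which by Robbins' theorem does not
   happen for connected bridgeless G. *)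
Definition bar_d (G : sgraph) : nat :=
  \big[minn/#|G|]_(A : {set G * G} |
      orientation (@edge G) (arcs A) && strong (arcs A)) diam (arcs A).

Section CycleGraph.
Variable mu : nat.

(* [i != j] only matters for mu = 1. *)
Definition cycle_edge : rel 'I_mu :=
  [rel i j | (i != j) && ((ordS i == j) || (ordS j == i))].

Fact cycle_edge_sym : symmetric cycle_edge.
Proof. by move=> i j; rewrite /cycle_edge /= eq_sym orbC. Qed.

Fact cycle_edge_irr : irreflexive cycle_edge.
Proof. by move=> i; rewrite /cycle_edge /= eqxx. Qed.

Definition cycle_graph : sgraph := SGraph cycle_edge_sym cycle_edge_irr.
End CycleGraph.

Section CartesianProduct.
Variables G H : sgraph.

Definition cart_edge : rel (G * H) :=
  [rel a b | (a.1 == b.1) && edge a.2 b.2 || edge a.1 b.1 && (a.2 == b.2)].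

Fact cart_edge_sym : symmetric cart_edge.
Proof.
by move=> a b; rewrite /cart_edge /= (eq_sym a.1) (eq_sym a.2) (edge_sym a.1) (edge_sym a.2).
Qed.

Fact cart_edge_irr : irreflexive cart_edge.
Proof. by move=> a; rewrite /cart_edge /= !edge_irr andbF. Qed.

Definition cart_prod : sgraph := SGraph cart_edge_sym cart_edge_irr.
End CartesianProduct.

Section VertexMultiplication.
Variables (G : sgraph) (s : G -> nat).

(* The block V_x consists of the pairs (x, i) with i < s x. *)
Definition vmult_edge : rel {x : G & 'I_(s x)} :=
  [rel u v | (tag u != tag v) && edge (tag u) (tag v)].

Fact vmult_edge_sym : symmetric vmult_edge.
Proof. by move=> u v; rewrite /vmult_edge /= eq_sym edge_sym. Qed.

Fact vmult_edge_irr : irreflexive vmult_edge.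
Proof. by move=> u; rewrite /vmult_edge /= eqxx. Qed.

Definition vmult : sgraph := SGraph vmult_edge_sym vmult_edge_irr.
End VertexMultiplication.

(* Membership of the vertex-multiplication G(s) in the class C_0.  Connectedness
   and bridgelessness of G(s) say that bar_d (G(s)) is defined. *)
Definition in_C0 (G : sgraph) (s : G -> nat) : Prop :=
  [/\ connected G,
      forall x : G, 2 <= s x,
      connected (vmult s),
      bridgeless (vmult s)
    & bar_d (vmult s) = gdiam G].

Arguments in_C0 G s : clear implicits.

(* Main.v *)
(* In any graph G, an orientation of G x {0,1} that has walks of lengths between
   1 and d(G) between any two vertices (equal or not) pulls back to G(s): one copy
   of each vertex gets the label 0, all others get 1.  Projecting walks to G gives
   bar_d (G(s)) >= d(G).

   For lambda >= 2 and mu >= 4, orient the double by a Z/2-voltage f with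
   f(v,u) = 1 + f(u,v): the arcs are (u,i) -> (v,i+f(u,v)).  Every walk of G lifts,
   and what is needed is a walk of each voltage.  Going back and forth along an edge
   adds 2 to the length and 1 to the voltage, which settles all pairs that agree in
   one coordinate, because both factors have diameter >= 2.  If both coordinates
   differ, the voltage of a geodesic can be changed by going around the first square
   the other way, provided that every square has voltage 1; a 2-colouring of the tree
   gives such an f.

   For lambda = mu = 3 no voltage works: two opposite leaves in the same copy of the
   tree are joined by a single walk of length <= 4.  The tree is a double star, and any
   two of its vertices lie in a homomorphic image of the double star with two leaves
   on each side; for the latter an explicit orientation on 36 vertices is checked by
   computation. *)
Require Import Defs.
From mathcomp Require Import all_boot.

Set Implicit Arguments.
Unset Strict Implicit.
Unset Printing Implicit Defensive.

(** * Walks, distance and diameter *)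

Section Distance.
Variables (T : finType) (e : rel T).

Lemma walkP k x y :
  reflect (exists p, [/\ path e x p, last x p = y & size p = k]) (walk e k x y).
Proof.
apply: (iffP existsP) => [[p /andP[ep /eqP lp]]|[p [ep lp sp]]].
  by exists p; rewrite size_tuple.
have sp' : size p == k by apply/eqP.
by exists (Tuple sp'); rewrite /= ep lp eqxx.
Qed.

Lemma dist_le_card x y : dist e x y <= #|T|.
Proof. by have := find_size (fun k => walk e k x y) (iota 0 #|T|); rewrite size_iota. Qed.

Lemma dist_le_size x p : path e x p -> dist e x (last x p) <= size p.
Proof.
move=> ep; have [Tp|pT] := leqP #|T| (size p).
  exact: leq_trans (dist_le_card _ _) Tp.
have ew : walk e (size p) x (last x p) by apply/walkP; exists p.
by rewrite leqNgt; apply/negP => /(before_find 0); rewrite nth_iota // add0n ew.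
Qed.

Lemma dist_path x y : connect e x y ->
  exists p, [/\ path e x p, last x p = y & size p = dist e x y].
Proof.
case/connectP=> p ep ->; case: (shortenP ep) => q eq uq _.
apply/walkP.
have hq : size q < #|T| by rewrite -[(size q).+1]/(size (x :: q)) -(card_uniqP uq) max_card.
have hw : has (fun k => walk e k x (last x q)) (iota 0 #|T|).
  by apply/hasP; exists (size q); [rewrite mem_iota | apply/walkP; exists q].
have := nth_find 0 hw; rewrite nth_iota ?add0n //.
by move: hw; rewrite has_find size_iota.
Qed.

Lemma dist_le_diam x y : dist e x y <= diam e.
Proof.
exact: leq_trans (leq_bigmax y) (leq_bigmax (F := fun x => \max_y dist e x y) x).
Qed.

Lemma diam_le k : (forall x y, dist e x y <= k) -> diam e <= k.
Proof. by move=> h; do 2!apply/bigmax_leqP => ? _. Qed.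

Lemma diam_attained : 0 < #|T| -> exists x y, dist e x y = diam e.
Proof.
move=> T0; have [x hx] := eq_bigmax (fun x => \max_y dist e x y) T0.
by have [y hy] := eq_bigmax (dist e x) T0; exists x, y; rewrite /diam hx hy.
Qed.

Lemma remove_edgeE x y u v : remove_edge e x y u v =
  e u v && ~~ ((u == x) && (v == y) || (u == y) && (v == x)).
Proof. by rewrite /remove_edge /= !inE !xpair_eqE. Qed.

End Distance.

(** * Strong orientations and bridges *)

(** The easy half of Robbins' theorem: if an edge is oriented from x to y, a directed path from y
    back to x avoids it. *)
Lemma strong_bridgeless (G : sgraph) (D : rel G) :
  orientation (@edge G) D -> strong D -> bridgeless G.
Proof.
move=> oD /andP[G0 sD] x y exy.
have oD' u v : if edge u v then D u v (+) D v u else ~~ D u v.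
  by move/forallP/(_ u)/forallP: oD.
have De u v : D u v -> edge u v by move=> Duv; move: (oD' u v); case: ifP; rewrite ?Duv.
wlog Dxy : x y exy / D x y.
  move=> wl; move: (oD' x y); rewrite exy; case Dxy: (D x y) => /= Dyx.
    exact: wl.
  have := wl y x; rewrite edge_sym exy Dyx => /(_ isT isT).
  rewrite /strong !G0 /=; congr is_true; apply: eq_forallb => u; apply: eq_forallb => v.
  by apply: eq_connect => a b; rewrite !remove_edgeE orbC.
set R := remove_edge _ _ _.
have symR : connect_sym R.
  apply: sym_connect_sym => u v; rewrite /R !remove_edgeE edge_sym.
  by rewrite orbC (andbC (v == x)) (andbC (v == y)).
have Dyx : D y x = false by move: (oD' x y); rewrite exy Dxy; case: (D y x).
have Rxy : connect R x y.
  rewrite symR; have /connectP[p] : connect D y x by move/forallP/(_ y)/forallP: sD.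
  (* On a path without repetition only the first arc touches y, and its head is not x because the
     edge is oriented from x to y. *)
  move=> Dp ->; case: (shortenP Dp) => -[//|z q] /= /andP[Dyz Dq] /andP[yq _] _.
  have Rq : path R z q.
    elim: q z {Dyz} Dq yq => //= w q IH z /andP[Dzw Dq].
    rewrite inE negb_or => /andP[yz yq]; rewrite IH // andbT.
    move: yq; rewrite inE negb_or => /andP[yw _].
    rewrite /R remove_edgeE De //= (eq_sym w) (eq_sym z y).
    by rewrite (negbTE yz) (negbTE yw) andbF.
  move: yq; rewrite inE negb_or => /andP[yz _].
  apply/connectP; exists (z :: q); rewrite //= Rq andbT /R remove_edgeE De //=.
  rewrite eqxx (eq_sym z y) (negbTE yz) andbF /=.
  by apply/eqP => zx; rewrite -zx Dyz in Dyx.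
apply/andP; split=> //; apply/forallP => u; apply/forallP => v.
have: connect D u v by move/forallP/(_ u)/forallP: sD.
apply: connect_sub => a b Dab.
have [/eqP[-> ->]//|nab] := boolP ((a, b) == (x, y)).
apply: connect1; rewrite /R remove_edgeE De //= -!xpair_eqE negb_or nab.
by apply/negP => /eqP[ay bx]; rewrite ay bx Dyx in Dab.
Qed.

Lemma bigminn_le (I : finType) (P : pred I) (F : I -> nat) m i :
  P i -> \big[minn/m]_(j | P j) F j <= F i.
Proof.
move=> Pi; have: i \in index_enum I by rewrite mem_index_enum.
elim: (index_enum I) => //= j r IH; rewrite inE big_cons => /predU1P[<-|/IH ir].
  by rewrite Pi geq_minl.
by case: ifP => // _; apply: leq_trans (geq_minr _ _) ir.
Qed.

(** * From an orientation of the double to the vertex-multiplication *)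

Section Doubling.
Variables (G : sgraph) (s : G -> nat) (O : rel (G * bool)).
Hypothesis G_conn : connected G.
Hypothesis s_ge2 : forall x : G, 2 <= s x.
Hypothesis O_orient :
  forall u v, if edge u.1 v.1 then O u v (+) O v u else ~~ O u v.
Hypothesis O_walk : forall u v,
  exists p, [/\ path O u p, last u p = v & 0 < size p <= gdiam G].

Definition vmult_double (p : vmult s) : G * bool := (tag p, tagged p != 0 :> nat).

Lemma vmult_double_surj u : exists p, vmult_double p == u.
Proof.
case: u => x b; have bs : b < s x by apply: leq_trans (s_ge2 x); case: b.
by exists (Tagged (fun y : G => 'I_(s y)) (Ordinal bs)); rewrite /vmult_double /=; case: b bs.
Qed.

Let lift u := xchoose (vmult_double_surj u).

Let liftK u : vmult_double (lift u) = u.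
Proof. exact/eqP/(xchooseP (vmult_double_surj u)). Qed.

Let A := [set pq : vmult s * vmult s | O (vmult_double pq.1) (vmult_double pq.2)].

Let D := arcs A.

Let DE p q : D p q = O (vmult_double p) (vmult_double q).
Proof. by rewrite /D /arcs /= inE. Qed.

Let O_edge u v : O u v -> edge u.1 v.1.
Proof. by move=> Ouv; move: (O_orient u v); rewrite Ouv; case: (edge _ _). Qed.

Let vmult_edgeE (p q : vmult s) : edge p q = edge (tag p) (tag q).
Proof.
rewrite -[LHS]/((tag p != tag q) && edge (tag p) (tag q)).
by case: eqP => // ->; rewrite edge_irr.
Qed.

Let D_orient : orientation (@edge (vmult s)) D.
Proof.
apply/forallP => p; apply/forallP => q.
by rewrite vmult_edgeE !DE; apply: (O_orient (vmult_double p) (vmult_double q)).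
Qed.

Let D_walk p q : exists2 r, path D p r & last p r = q /\ size r <= gdiam G.
Proof.
have [r [Or lr /andP[r0 rd]]] := O_walk (vmult_double p) (vmult_double q).
(* Inner vertices may be lifted to any preimage, but the end must be q itself. Distinct p and q can
   have the same image, so the walk between the images must be nonempty. *)
case/lastP: r => // r w in Or lr r0 rd *.
rewrite last_rcons in lr; exists (rcons (map lift r) q); last first.
  by rewrite last_rcons size_rcons size_map -(size_rcons r w).
rewrite (eq_path DE) -path_map map_rcons -map_comp -lr.
by rewrite (eq_map (g := id)) ?map_id // => u /=; rewrite liftK.
Qed.

Let D_strong : strong D.
Proof.
apply/andP; split.
  case/andP: G_conn => /card_gt0P[x _] _; apply/card_gt0P.
  by exists (lift (x, true)).
apply/forallP => p; apply/forallP => q.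
by have [r Dr [rq _]] := D_walk p q; apply/connectP; exists r.
Qed.

Let D_diam : diam D <= gdiam G.
Proof.
apply: diam_le => p q; have [r Dr [<- rd]] := D_walk p q.
exact: leq_trans (dist_le_size Dr) rd.
Qed.

Lemma gdiam_le_vmult (E : rel (vmult s)) :
  orientation (@edge (vmult s)) E -> strong E -> gdiam G <= diam E.
Proof.
move=> oE sE; apply: diam_le => x y.
pose p := lift (x, true); pose q := lift (y, true).
have tagp : tag p = x by rewrite -[x]/((x, true).1) -(liftK (x, true)).
have tagq : tag q = y by rewrite -[y]/((y, true).1) -(liftK (y, true)).
have /dist_path[r [Er rq rd]] : connect E p q.
  by case/andP: sE => _ /forallP/(_ p)/forallP.
apply: leq_trans _ (dist_le_diam E p q); rewrite -rd -(size_map tag r).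
rewrite -tagq -rq -tagp -last_map; apply: dist_le_size.
rewrite path_map; apply: sub_path Er => a b Eab /=.
by move/forallP/(_ a)/forallP/(_ b): oE; rewrite vmult_edgeE Eab; case: (edge _ _).
Qed.

Lemma double_in_C0 : in_C0 G s.
Proof.
split=> //.
- case/andP: D_strong => V0 /forallP cD; apply/andP; split=> //.
  apply/forallP => p; apply/forallP => q; move/(_ p)/forallP/(_ q): cD.
  by apply: connect_sub => a b; rewrite DE => /O_edge eab; apply: connect1; rewrite vmult_edgeE.
- exact: strong_bridgeless D_orient D_strong.
apply/eqP; rewrite eqn_leq; apply/andP; split.
  apply: leq_trans D_diam; apply: (bigminn_le (fun B => diam (arcs B)) _ (i := A)).
  by rewrite D_strong andbT.
rewrite /bar_d; elim/big_ind: _ => [|m n Gm Gn|B /andP[]].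
(* The default value of the minimum: distances in G are at most #|G|, and G embeds into the
   multiplication. *)
- apply: diam_le => x y; apply: leq_trans (dist_le_card _ _ _) _.
  apply: (leq_card (fun z => lift (z, true))) => z1 z2 eqz.
  by have := congr1 vmult_double eqz; rewrite !liftK => -[].
- by rewrite leq_min Gm.
- exact: gdiam_le_vmult.
Qed.

End Doubling.

(** * Odd closed walks and the 2-colouring of a tree *)

Lemma rot_not_uniq (T : eqType) (p : seq T) :
  ~~ uniq p -> exists i x q1 q2, rot i p = x :: q1 ++ x :: q2.
Proof.
case: p => // x0 p /(uniqPn x0)[i [j [ij jp eij]]]; set s := x0 :: p in jp eij *.
have xd : nth x0 s i \in drop i.+1 s.
  rewrite eij -[j](subnKC ij) -nth_drop mem_nth // size_drop ltn_sub2r //.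
  exact: leq_ltn_trans ij jp.
exists i, (nth x0 s i); rewrite /rot (drop_nth x0) ?(ltn_trans ij) //.
by case/splitPr: xd => q1 q2; exists q1, (q2 ++ take i s); rewrite /= -catA.
Qed.

(** A closed walk with a repeated vertex splits there into two shorter ones, and one of them is odd.
    Irreflexivity excludes length 1. *)
Lemma odd_cycle_ucycle (T : eqType) (e : rel T) (p : seq T) :
  irreflexive e -> cycle e p -> odd (size p) ->
  exists2 q, ucycle e q & 2 < size q.
Proof.
move=> e_irr; have [n] := ubnP (size p); elim: n p => // n IH p pn ep op.
have [up|/rot_not_uniq[i [x [q1 [q2 def_p]]]]] := boolP (uniq p).
  exists p; first by rewrite /ucycle ep.
  by case: p ep op {pn up} => [|x [|y []]] //=; rewrite e_irr.
have sp : size p = size (x :: q1) + size (x :: q2).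
  by rewrite -(size_rot i) def_p /= size_cat.
move: ep; rewrite -(rot_cycle i) def_p /= -cat_rcons rcons_cat cat_path last_rcons.
case/andP=> e1 e2; move: op; rewrite sp oddD.
have [o1 _|_ /= o2] := boolP (odd (size (x :: q1))).
  by apply: (IH (x :: q1)) => //; rewrite -ltnS (leq_trans _ pn) // sp /= !addnS !ltnS leq_addr.
by apply: (IH (x :: q2)) => //; rewrite -ltnS (leq_trans _ pn) // sp /= !addSn !ltnS leq_addl.
Qed.

Lemma tree_bipartite (G : sgraph) : tree G ->
  exists col : G -> bool, forall u v, edge u v -> col v = ~~ col u.
Proof.
case=> /andP[/card_gt0P[r _] conG] acyc.
have geo v := dist_path (forallP (forallP conG r) v).
exists (fun v => odd (dist (@edge G) r v)) => u v euv.
have [[p [ep lp <-]] [q [eq lq <-]]] := (geo u, geo v).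
have [|odd_pq] := eqVneq (odd (size q)) (~~ odd (size p)); first by [].
(* If u and v had the same parity, then going from r to u, across the edge uv, and back from v to r
   would be an odd closed walk. *)
pose c := p ++ v :: rev (belast r q).
have ec : path (@edge G) r c.
  rewrite cat_path ep lp /= euv -lq rev_path.
  by rewrite (eq_path (e' := @edge G)) // => x y; apply: edge_sym.
have lc : last r c = r.
  by rewrite last_cat /=; case: (q) lq => //= x q' _; rewrite rev_cons last_rcons.
have oc : odd (size c).
  rewrite size_cat /= size_rev size_belast addnS /= oddD.
  by move: odd_pq; case: odd; case: odd.
have [] // := odd_cycle_ucycle (@edge_irr G) _ oc; last by move=> w uw /acyc /(_ uw).
case/lastP: (c) ec lc => // c' x; rewrite last_rcons => ec xr.
by move: ec; rewrite -(rot_cycle (size c')) -cats1 rot_size_cat /= xr cats1.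
Qed.

Lemma connected_neighbour (G : sgraph) :
  connected G -> 0 < gdiam G -> forall v : G, exists w, edge v w.
Proof.
move=> /andP[_ cG] dG v; have [w vw|nov] := pickP (edge v); first by exists w.
have all_v u : u = v.
  have /connectP[[|w p] /=] := forallP (forallP cG v) u; first by [].
  by rewrite nov.
move: dG; rewrite ltnNge => /negP[]; apply: diam_le => x y.
by rewrite (all_v x) (all_v y); apply: (@dist_le_size _ (@edge G) v [::]).
Qed.

(** * Voltages and lifted walks *)

Section Voltage.
Variables (G : sgraph) (f : G -> G -> bool).
Hypothesis f_anti : forall u v, edge u v -> f v u = ~~ f u v.

Definition lift_rel : rel (G * bool) :=
  [rel u v | edge u.1 v.1 && (v.2 == u.2 (+) f u.1 v.1)].

(** Length n and voltage b. Both starting labels are covered, so that walks can be concatenated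
    whatever label the first one ends with. *)
Definition lifted_walk u v n b := forall i, exists p,
  [/\ path lift_rel (u, i) p, last (u, i) p = (v, i (+) b) & size p = n].

Lemma lifted_walk0 u : lifted_walk u u 0 false.
Proof. by move=> i; exists [::]; rewrite addbF. Qed.

Lemma lifted_walk1 u v : edge u v -> lifted_walk u v 1 (f u v).
Proof. by move=> uv i; exists [:: (v, i (+) f u v)]; rewrite /= /lift_rel /= uv eqxx. Qed.

Lemma lifted_walk_cat v u w m n b c :
  lifted_walk u v m b -> lifted_walk v w n c -> lifted_walk u w (m + n) (b (+) c).
Proof.
move=> uv vw i; have [p [ep lp sp]] := uv i; have [q [eq lq sq]] := vw (i (+) b).
by exists (p ++ q); rewrite cat_path last_cat size_cat ep lp eq lq sp sq addbA.
Qed.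

Lemma lifted_walk_path u p :
  path (@edge G) u p -> exists b, lifted_walk u (last u p) (size p) b.
Proof.
elim: p u => [|v p IH] u /=; first by exists false; apply: lifted_walk0.
case/andP=> /lifted_walk1 uv /IH[b vp]; exists (f u v (+) b).
exact: lifted_walk_cat uv vp.
Qed.

Lemma lifted_walk_detour v w : edge v w -> lifted_walk v v 2 true.
Proof.
move=> vw; have wv : edge w v by rewrite edge_sym.
have := lifted_walk_cat (lifted_walk1 vw) (lifted_walk1 wv).
by rewrite (f_anti vw) addbN addbb.
Qed.

Lemma short_lifted_walk u v w m b c d : edge v w -> lifted_walk u v m b ->
  m.+2 <= d -> 4 <= d -> exists2 n, lifted_walk u v n c & 0 < n <= d.
Proof.
move=> /lifted_walk_detour vv uv md d4; have uvv := lifted_walk_cat uv vv.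
have [cb|cb] := eqVneq c b; last first.
  exists (m + 2); last by rewrite addn2.
  by have -> : c = b (+) true by move: cb; case: (b); case: (c).
case: m uv md uvv => [|m] uv md uvv; last first.
  by exists m.+1; [rewrite cb | exact: ltnW (ltnW md)].
(* The empty walk has the right voltage but length 0; two detours replace it, which is where
   [4 <= d] enters. *)
by exists 4 => //; rewrite cb -[b]addbF -(addbb true) addbA; apply: lifted_walk_cat uvv vv.
Qed.

Lemma voltage_in_C0 (s : G -> nat) : connected G -> (forall x, 2 <= s x) ->
  (forall u v b, exists2 n, lifted_walk u v n b & 0 < n <= gdiam G) ->
  in_C0 G s.
Proof.
move=> conG s2 hw; apply: (@double_in_C0 G s lift_rel) => //.
  move=> [u i] [v j]; rewrite /lift_rel /= (edge_sym v).
  by case: (boolP (edge u v)) => //= uv; rewrite (f_anti uv); case: i j (f u v) => [] [] [].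
move=> [u i] [v j]; have [n uv /andP[n0 nd]] := hw u v (i (+) j).
have [p [ep lp sp]] := uv i; exists p.
by rewrite sp n0 nd lp addKb.
Qed.

End Voltage.

(** * Products with a bipartite factor *)

Section Product.
Variables G H : sgraph.
Let GH := cart_prod G H.

Lemma cart_edgeE (u v : GH) : edge u v =
  (u.1 == v.1) && edge u.2 v.2 || edge u.1 v.1 && (u.2 == v.2).
Proof. by []. Qed.

Lemma cart_edge1 a b x : edge a b -> @edge GH (a, x) (b, x).
Proof. by rewrite cart_edgeE /= eqxx andbT => ->; rewrite orbT. Qed.

Lemma cart_edge2 a x y : edge x y -> @edge GH (a, x) (a, y).
Proof. by rewrite cart_edgeE /= eqxx => ->. Qed.

Lemma cart_path1 x a p :
  path (@edge G) a p -> path (@edge GH) (a, x) (map (pair^~ x) p).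
Proof. by apply: (homo_path (f := pair^~ x)) => b c; apply: cart_edge1. Qed.

Lemma cart_path2 a x p :
  path (@edge H) x p -> path (@edge GH) (a, x) (map (pair a) p).
Proof. by apply: (homo_path (f := pair a)) => y z; apply: cart_edge2. Qed.

Lemma cart_connected : connected G -> connected H -> connected GH.
Proof.
case/andP=> G0 cG /andP[H0 cH]; apply/andP; split; first by rewrite card_prod muln_gt0 G0.
apply/forallP => -[a x]; apply/forallP => -[b y].
move/forallP/(_ a)/forallP/(_ b)/connectP: cG => [p ep ->].
move/forallP/(_ x)/forallP/(_ y)/connectP: cH => [q eq ->].
apply/connectP; exists (map (pair^~ x) p ++ map (pair (last a p)) q).
  by rewrite cat_path cart_path1 // (last_map (pair^~ x)) cart_path2.
by rewrite last_cat (last_map (pair^~ x)) last_map.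
Qed.

(** Each step of a walk in the product moves exactly one coordinate, so the lengths of the two
    projections add up. *)
Lemma cart_path_proj (u : GH) p : path (@edge GH) u p ->
  dist (@edge G) u.1 (last u p).1 + dist (@edge H) u.2 (last u p).2 <= size p.
Proof.
move=> ep.
have [q [r [eq [<- [er [<- <-]]]]]] : exists q r, path (@edge G) u.1 q /\
  (last u.1 q = (last u p).1 /\ (path (@edge H) u.2 r /\
  (last u.2 r = (last u p).2 /\ size q + size r = size p))).
  elim: p u ep => [|v p IH] u /=; first by exists [::], [::].
  case/andP=> uv /IH[q [r [eq [lq [er [lr <-]]]]]].
  case/orP: uv => /andP[]; [move=> /eqP-> e2 | move=> e1 /eqP->].
    by exists q, (v.2 :: r); rewrite /= e2 addnS.
  by exists (v.1 :: q), r; rewrite /= e1.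
by rewrite leq_add ?dist_le_size.
Qed.

Lemma cart_gdiam : connected G -> connected H -> gdiam G + gdiam H <= gdiam GH.
Proof.
move=> cG cH; have /andP[_ cGH] := cart_connected cG cH.
case/andP: cG => G0 _; case/andP: cH => H0 _.
have [a [b ab]] := diam_attained (@edge G) G0.
have [x [y xy]] := diam_attained (@edge H) H0.
apply: leq_trans _ (dist_le_diam (@edge GH) (a, x) (b, y)).
have [p [ep lp <-]] := dist_path (forallP (forallP cGH (a, x)) (b, y)).
by have := cart_path_proj ep; rewrite lp /= ab xy.
Qed.

Variable col : G -> bool.
Hypothesis colP : forall a b, edge a b -> col b = ~~ col a.

(** On edges of G the voltage is the colour of the tail, the same in all copies of G. On edges of H
    it comes from an arbitrary linear order, reversed in the copies of H at vertices of the other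
    colour. Thus every square has voltage 1. *)
Let f (u v : GH) : bool :=
  if u.1 == v.1 then (enum_rank u.2 < enum_rank v.2) (+) col u.1 else col u.1.

Lemma bipartite_cart_in_C0 (s : GH -> nat) :
  connected G -> connected H -> 2 <= gdiam G -> 2 <= gdiam H ->
  (forall v, 2 <= s v) -> in_C0 GH s.
Proof.
move=> cG cH dG dH s2; have cGH := cart_connected cG cH.
have le_d := cart_gdiam cG cH.
have d4 : 4 <= gdiam GH by apply: leq_trans (leq_add dG dH) le_d.
have f_anti u v : edge u v -> f v u = ~~ f u v.
  case: u v => [a x] [b y]; rewrite cart_edgeE /f /= => uv.
  rewrite (eq_sym b a); case: eqP uv => /= [<-|_ /andP[/colP //]].
  rewrite edge_irr orbF -addNb -leqNgt ltn_neqAle => xy.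
  suff -> : enum_rank y != enum_rank x :> nat by [].
  by apply: contraTneq xy => /val_inj /enum_rank_inj ->; rewrite edge_irr.
apply: (@voltage_in_C0 GH f f_anti s cGH s2) => -[a x] [b y] c.
have [p [ep lp sp]] := dist_path (forallP (forallP (proj2 (andP cG)) a) b).
have [q [eq lq sq]] := dist_path (forallP (forallP (proj2 (andP cH)) x) y).
have pd : size p <= gdiam G by rewrite sp dist_le_diam.
have qd : size q <= gdiam H by rewrite sq dist_le_diam.
have [z bz] := connected_neighbour cG (ltnW dG) b.
have pathGH : path (@edge GH) (a, x) (map (pair^~ x) p ++ map (pair b) q).
  by rewrite cat_path cart_path1 // (last_map (pair^~ x)) lp cart_path2.
have lastGH : last (a, x) (map (pair^~ x) p ++ map (pair b) q) = (b, y).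
  by rewrite last_cat (last_map (pair^~ x)) lp last_map lq.
have short : (size p + size q).+2 <= gdiam GH ->
    exists2 n, lifted_walk f (a, x) (b, y) n c & 0 < n <= gdiam GH.
  move=> pqd; have [e] := lifted_walk_path f pathGH.
  rewrite lastGH size_cat !size_map => w.
  exact: (short_lifted_walk f_anti c (cart_edge1 y bz) w pqd d4).
(* If one coordinate agrees, the geodesic lies in a copy of the other factor, and the diameter of
   the idle factor, at least 2, leaves room for a detour. *)
case: p => [|a1 p] in ep lp sp pd pathGH lastGH short *.
  apply: short; apply: leq_trans le_d; rewrite add0n -add2n.
  exact: leq_add.
case: q => [|x1 q] in eq lq sq qd pathGH lastGH short *.
  apply: short; apply: leq_trans le_d; rewrite addn0 -addn2.
  exact: leq_add.
case/andP: ep => aa1 ep; case/andP: eq => xx1 eq.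
(* The two ways across the first square differ in voltage, so every i is realised. *)
have square i : lifted_walk f (a, x) (a1, x1) 2 i.
  have w1 := lifted_walk_cat (lifted_walk1 f (cart_edge1 x aa1))
                             (lifted_walk1 f (cart_edge2 a1 xx1)).
  have w2 := lifted_walk_cat (lifted_walk1 f (cart_edge2 a xx1))
                             (lifted_walk1 f (cart_edge1 x1 aa1)).
  have [->|i1] := eqVneq i (f (a, x) (a1, x) (+) f (a1, x) (a1, x1)); first by [].
  suff -> : i = f (a, x) (a, x1) (+) f (a, x1) (a1, x1) by [].
  move: i1; rewrite /f /= !eqxx (colP aa1).
  have -> : (a == a1) = false by apply: contraTF aa1 => /eqP->; rewrite edge_irr.
  by case: i; case: (col a); case: (_ < _).
have [d wp] := lifted_walk_path f (cart_path1 x1 ep).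
have [e wq] := lifted_walk_path f (cart_path2 b eq).
rewrite /= in lp lq; rewrite (last_map (pair^~ x1)) lp size_map in wp.
rewrite last_map lq size_map in wq.
(* The voltage of the square is chosen to cancel d and e of the remaining walk, leaving c. *)
have := lifted_walk_cat (square (c (+) (d (+) e))) (lifted_walk_cat wp wq).
rewrite -addbA addbb addbF => w.
exists (2 + (size p + size q)) => //; apply: leq_trans le_d.
by rewrite add2n -addnS -addSn; apply: leq_add.
Qed.
End Product.

(** * Cycles *)

Lemma cycle_connected mu : 0 < mu -> connected (cycle_graph mu).
Proof.
case: mu => // m _; set C := cycle_graph _.
have c0 k (km : k < m.+1) : connect (@edge C) ord0 (Ordinal km).
  elim: k km => [|k IH] km; first by have -> : Ordinal km = ord0 by apply: val_inj.
  apply: connect_trans (IH (ltnW km)) (connect1 _).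
  by rewrite /= /cycle_edge /= -!val_eqE /= modn_small // eqxx neq_ltn ltnSn.
apply/andP; split; first by rewrite card_ord.
apply/forallP => i; apply/forallP => j.
have symC : connect_sym (@edge C) by apply: sym_connect_sym; apply: edge_sym.
case: i j => [i im] [j jm]; apply: connect_trans (c0 j jm).
by rewrite symC; apply: c0.
Qed.

(** The vertices 0 and 2 are distinct and, as [4 <= mu], not adjacent. *)
Lemma cycle_gdiam_ge2 mu : 4 <= mu -> 2 <= gdiam (cycle_graph mu).
Proof.
move=> mu4; have [mu0 mu2] : 0 < mu /\ 2 < mu by rewrite !(leq_trans _ mu4).
have [p [ep lp sp]] : exists p, [/\ path (@edge (cycle_graph mu)) (Ordinal mu0) p,
    last (Ordinal mu0) p = Ordinal mu2 &
    size p = dist (@edge (cycle_graph mu)) (Ordinal mu0) (Ordinal mu2)].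
  by apply: dist_path; case/andP: (cycle_connected mu0) => _ /forallP/(_ (Ordinal mu0))/forallP.
apply: leq_trans (dist_le_diam _ (Ordinal mu0) (Ordinal mu2)); rewrite -sp.
case: p ep lp {sp} => [|x [|]] //=.
rewrite andbT => + xE; rewrite {}xE /= /cycle_edge /= -!val_eqE /=.
by rewrite !modn_small ?(leq_trans _ mu4).
Qed.

(** * Trees of diameter 3 are double stars *)

Lemma edge_neq (G : sgraph) (x y : G) : edge x y -> x != y.
Proof. by apply: contraTneq => ->; rewrite edge_irr. Qed.

Lemma tree_C4_free (G : sgraph) (x y z w : G) : tree G ->
  edge x y -> edge y z -> edge z w -> edge w x -> x != z -> y != w -> False.
Proof.
case=> _ acyc xy yz zw wx xz yw.
apply: (acyc [:: x; y; z; w]) => //; rewrite /ucycle /= xy yz zw wx /=.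
by rewrite !inE !negb_or xz yw !edge_neq // edge_sym.
Qed.

(** A walk of length 4 in a tree that never turns back is a geodesic. The 2-colouring makes the
    distance even; distance 0 would give a 4-cycle, distance 2 a 4-cycle or a 6-cycle. *)
Lemma tree_dist4 (G : sgraph) (v u c d b : G) : tree G ->
  edge v u -> edge u c -> edge c d -> edge d b ->
  v != c -> u != d -> c != b -> 4 <= dist (@edge G) v b.
Proof.
move=> tG vu uc cd db vc ud cb; have [col colP] := tree_bipartite tG.
have neq (x y : G) : col x != col y -> x != y by apply: contraNneq => ->.
have [/andP[_ conG] acyc] := tG.
have vb : v != b.
  by apply/eqP => vb; apply: (tree_C4_free tG vu uc cd); rewrite // vb.
have [p [ep lp <-]] := dist_path (forallP (forallP conG v) b).
have colu := colP _ _ vu; have colc := colP _ _ uc; have cold := colP _ _ cd.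
have colb := colP _ _ db; rewrite cold colc colu !negbK in colb.
case: p ep lp => [|z [|y [|w [|]]]] //=.
- by move=> _ vb'; rewrite vb' eqxx in vb.
- by rewrite andbT => /colP + zb; rewrite zb colb; case: (col v).
- move=> /and3P[vz zy _] yb; rewrite {y}yb in zy.
  have colz := colP _ _ vz.
  have zu : z != u.
    apply/eqP => zu; rewrite zu edge_sym in zy.
    by apply: (tree_C4_free tG uc cd db zy).
  have zd : z != d.
    apply/eqP => zd; rewrite zd edge_sym in vz.
    by apply: (tree_C4_free tG vu uc cd vz).
  exfalso; apply: (acyc [:: v; u; c; d; b; z]) => //.
  rewrite /ucycle /= vu uc cd db (edge_sym b) zy (edge_sym z) vz /=.
  rewrite !inE !negb_or vc vb ud cb (eq_sym u z) zu (eq_sym d z) zd.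
  by rewrite !neq // ?colz ?colb ?cold ?colc ?colu; case: (col v).
- move=> /and4P[/colP vz /colP zy /colP yw _] wb.
  by move: yw; rewrite wb colb zy vz; case: (col v).
Qed.

(** A geodesic a, c, d, b realises the diameter. A vertex v outside the star with a neighbour u in
    it would start a walk v, u, c, d, b or v, u, d, c, a without turning back, hence have distance 4
    to b or a. *)
Lemma double_star (G : sgraph) : tree G -> gdiam G = 3 ->
  exists a b c d : G, [/\ edge a c, edge c d, edge d b, a != d /\ b != c &
    forall v, [|| v == c, v == d, edge v c | edge v d]].
Proof.
move=> tG dG; have [/andP[G0 conG] _] := tG.
have con := fun x y => forallP (forallP conG x) y.
have [a [b ab]] := diam_attained (@edge G) G0.
have [p [ep lp sp]] := dist_path (con a b).
case: p ep lp sp => [|c [|d [|b' []]]] /=; rewrite ab -/(gdiam G) dG //.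
move=> /and4P[ac cd db _] eb _; rewrite {b'}eb in db.
have ad : a != d.
  apply: contraTneq isT => ad; move: ab; rewrite -/(gdiam G) dG ad.
  by have := @dist_le_size _ (@edge G) d [:: b]; rewrite /= db => /(_ isT) /[swap] ->.
have bc : b != c.
  apply: contraTneq isT => bc; move: ab; rewrite -/(gdiam G) dG bc.
  by have := @dist_le_size _ (@edge G) a [:: c]; rewrite /= ac => /(_ isT) /[swap] ->.
exists a, b, c, d; split=> // v.
have le3 x y : ~ 4 <= dist (@edge G) x y by rewrite -dG; apply/negP; rewrite -leqNgt dist_le_diam.
pose S v := [|| v == c, v == d, edge v c | edge v d].
suff S_path q u : path (@edge G) u q -> S u -> S (last u q).
  have /connectP[q eq ->] := con c v.
  by apply: S_path; rewrite // /S eqxx.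
elim: q u => //= {}v q IH u /andP[uv eq] Su; apply: IH eq _.
apply: contraT; rewrite !negb_or => /and4P[vc vd nvc nvd].
have uc : u != c by apply: contraNneq nvc => <-; rewrite edge_sym.
have ud : u != d by apply: contraNneq nvd => <-; rewrite edge_sym.
rewrite edge_sym in uv.
case/or4P: Su => [/eqP cu|/eqP du|uc'|ud'].
- by rewrite cu eqxx in uc.
- by rewrite du eqxx in ud.
- by case: (le3 v b); apply: (tree_dist4 tG uv uc' cd db) => //; rewrite eq_sym.
- case: (le3 v a); apply: (tree_dist4 (c := d) (d := c) tG uv ud') => //;
  by rewrite // 1?edge_sym // eq_sym.
Qed.

Lemma gdiam_gt0 (G : sgraph) (x y : G) : connected G -> x != y -> 0 < gdiam G.
Proof.
move=> /andP[_ /forallP/(_ x)/forallP/(_ y)/dist_path[p [_ lp sp]]] xy.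
apply: leq_trans (dist_le_diam _ x y); rewrite -sp.
by case: p lp {sp} => //= xy'; rewrite xy' eqxx in xy.
Qed.

(** * The explicit orientation and its check by computation *)

(** Starting from the out-neighbours of u excludes the empty walk, so n rounds give lengths 1 to n +
    1. Filtering V keeps its order, which allows comparison with V as lists. *)
Definition reach (T : eqType) (e : rel T) (V : seq T) n u :=
  iter n (fun L => [seq v <- V | (v \in L) || has (e^~ v) L])
    [seq v <- V | e u v].

Lemma reach_path (T : eqType) (e : rel T) (V : seq T) n u v :
  v \in reach e V n u ->
  exists p, [/\ path e u p, last u p = v & 0 < size p <= n.+1].
Proof.
elim: n v => [|n IH] v; rewrite /reach /= mem_filter.
  by case/andP=> uv _; exists [:: v]; rewrite /= uv.
case/andP=> /orP[/IH[p [ep lp /andP[p0 pn]]]|/hasP[w /IH[p [ep lp /andP[p0 pn]]] wv]] _.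
  by exists p; rewrite p0 leqW.
by exists (rcons p v); rewrite rcons_path last_rcons size_rcons ep lp.
Qed.

(* Found by computer search among the orientations invariant under rotation of the
   triangle.  In (t, x, i), t is the position 0 - 1 - 2 - 3 on a longest path of the
   double star, x the vertex of the triangle and i the label of the copy; [level]
   orients the edges from x to x + 1 and [up] those from t to t + 1. *)
Definition star_arc : rel (nat * nat * bool) := fun u v =>
  let '(t, x, i) := u in let '(t', x', j) := v in
  let level t i j := nth (i == j) [:: i == j; i == j; ~~ i; ~~ j] t in
  let up t i j := nth i [:: ~~ j; ~~ i; i] t in
  if t == t' then if x' == x.+1 %% 3 then level t i j else ~~ level t j i
  else if t < t' then up t i j else ~~ up t' j i.
Arguments star_arc : simpl never.

(** Of two distinct vertices of a triangle exactly one is the successor of the other, so the two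
    branches within a level are complementary. *)
Lemma star_arc_anti u v : u.1.2 < 3 -> v.1.2 < 3 -> u.1 != v.1 ->
  star_arc v u = ~~ star_arc u v.
Proof.
case: u v => [[t x] i] [[t' x'] j] /= x3 x'3.
rewrite /star_arc xpair_eqE; case: (ltngtP t t') => //=.
  by rewrite negbK.
move: x x' x3 x'3 => [|[|[|]]] // [|[|[|]]] //= _ _ -> _.
all: by rewrite ?negbK.
Qed.

(* The double star has centres 1, 2 and leaves 0, 4 at 1 and 3, 5 at 2. *)
Definition leaf_type k := nth 0 [:: 0; 1; 2; 3; 0; 3] k.

(** Vertices of a double star are adjacent exactly when their types differ by 1. *)
Definition model_arc : rel (nat * nat * bool) := fun u v =>
  let '(k, x, i) := u in let '(l, y, j) := v in
  let s := leaf_type k in let t := leaf_type l in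
  ((k == l) && [&& x != y, x < 3 & y < 3] ||
   ((s.+1 == t) || (t.+1 == s)) && (x == y))
  && star_arc (s, x, i) (t, y, j).

Definition model_vertices :=
  [seq (kx, i) | kx <- [seq (k, x) | k <- iota 0 6, x <- iota 0 3],
                 i <- [:: false; true]].

Lemma model_diam :
  all (fun u => reach model_arc model_vertices 3 u == model_vertices) model_vertices.
Proof. by vm_compute. Qed.

Lemma model_walk u v : u \in model_vertices -> v \in model_vertices ->
  exists p, [/\ path model_arc u p, last u p = v & 0 < size p <= 4].
Proof.
by move=> uV vV; apply: (@reach_path _ _ model_vertices); rewrite (eqP (allP model_diam u uV)) vV.
Qed.

(** * Transfer from the model to every double star *)

Section DoubleStar.
Variables (G : sgraph) (a b c d : G).
Hypothesis G_tree : tree G.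
Hypotheses (ac : edge a c) (cd : edge c d) (db : edge d b).
Hypotheses (ad : a != d) (bc : b != c).
Hypothesis G_star : forall v, [|| v == c, v == d, edge v c | edge v d].

Definition star_type v :=
  if v == c then 1 else if v == d then 2 else if edge v c then 0 else 3.

Let no_triangle (x y z : G) : edge x y -> edge y z -> edge x z = false.
Proof.
have [col colP] := tree_bipartite G_tree => xy yz; apply/negP => /colP xz.
by move: (colP _ _ yz); rewrite xz (colP _ _ xy); case: (col x).
Qed.

(** Adjacent leaves of the same type would form a triangle with their centre. *)
Lemma star_type_edge u v : edge u v -> star_type u != star_type v.
Proof.
move=> uv; apply/eqP; rewrite /star_type.
have [uc|uc] := eqVneq u c; have [vc|vc] := eqVneq v c.
- by rewrite uc vc edge_irr in uv.
- by case: ifP => // _; case: ifP.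
- by case: ifP => // _; case: ifP.
have [ud|ud] := eqVneq u d; have [vd|vd] := eqVneq v d.
- by rewrite ud vd edge_irr in uv.
- by case: ifP.
- by case: ifP.
case: ifP => euc; case: ifP => evc // _; first by rewrite (no_triangle uv evc) in euc.
have := G_star u; have := G_star v.
rewrite (negbTE uc) (negbTE vc) (negbTE ud) (negbTE vd) euc evc /= => evd.
by rewrite (no_triangle uv evd).
Qed.

Let GC := cart_prod G (cycle_graph 3).

Let triple (u : GC * bool) : nat * nat * bool := (star_type u.1.1, val u.1.2, u.2).

Let O : rel (GC * bool) :=
  [rel u v | edge u.1 v.1 && star_arc (triple u) (triple v)].

Let OE u v : O u v = edge u.1 v.1 && star_arc (triple u) (triple v).
Proof. by []. Qed.

Let O_orient u v : if edge u.1 v.1 then O u v (+) O v u else ~~ O u v.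
Proof.
rewrite !OE (edge_sym v.1); have [e|//] := boolP (edge u.1 v.1).
rewrite !andTb (@star_arc_anti (triple u)) ?ltn_ord ?addbN ?addbb // xpair_eqE negb_and.
move: e; rewrite cart_edgeE => /orP[] /andP[].
  by move=> _ /edge_neq; rewrite -val_eqE => uv; apply/orP; right.
by move=> /star_type_edge uv _; apply/orP; left.
Qed.

(** This makes every type-preserving map from the model to the tree a homomorphism. *)
Lemma star_type_succ p q : (star_type p).+1 = star_type q -> edge p q.
Proof.
have := G_star q; rewrite /star_type; have [->|pc] := eqVneq p c.
  have [//|qc] := eqVneq q c; have [-> //|qd] := eqVneq q d.
  by case: ifP.
have [->|pd] := eqVneq p d.
  have [//|qc] := eqVneq q c; have [//|qd] := eqVneq q d.
  by case: ifP => //= _ qd' _; rewrite edge_sym.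
have [epc _|//] := boolP (edge p c).
  by have [->|qc] := eqVneq q c; last by case: ifP => // _; case: ifP.
by have [//|qc] := eqVneq q c; case: ifP => // _; case: ifP.
Qed.

(* A homomorphism from the six-vertex double star whose image contains u and v. *)
Let star_leaf u v k := nth a
  [:: if star_type u == 0 then u else a; c; d; if star_type u == 3 then u else b;
      if star_type v == 0 then v else a; if star_type v == 3 then v else b] k.

Let star_leaf_type u v k : star_type (star_leaf u v k) = leaf_type k.
Proof.
have ta : star_type a = 0 by rewrite /star_type (negbTE (edge_neq ac)) (negbTE ad) ac.
have tc : star_type c = 1 by rewrite /star_type eqxx.
have td : star_type d = 2.
  by rewrite /star_type eqxx; have := edge_neq cd; rewrite eq_sym => /negbTE->.
have tb : star_type b = 3.
  have bd : edge b d by rewrite edge_sym.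
  have dc : edge d c by rewrite edge_sym.
  by rewrite /star_type (negbTE bc) (negbTE (edge_neq bd)) (no_triangle bd dc).
by case: k => [|[|[|[|[|[|k]]]]]]; rewrite /star_leaf /leaf_type /= ?nth_nil //; case: eqP.
Qed.

Let star_leaf_cover u v :
  (exists k, k < 6 /\ star_leaf u v k = u) /\ exists k, k < 6 /\ star_leaf u v k = v.
Proof.
have tc w : star_type w = 1 -> w = c.
  by rewrite /star_type; case: eqP => // _; case: eqP => // _; case: ifP.
have td w : star_type w = 2 -> w = d.
  by rewrite /star_type; case: eqP => // _; case: eqP => // _; case: ifP.
have t3 w : star_type w <= 3.
  by rewrite /star_type; case: eqP => // _; case: eqP => // _; case: ifP.
(* The vertex u sits at the index equal to its type; a leaf v takes the second leaf, 4 or 5, so that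
   u and v may be distinct leaves of one type. *)
split; [exists (star_type u) | exists (nth 0 [:: 4; 1; 2; 5] (star_type v))].
  rewrite (leq_ltn_trans (t3 u)) //; split=> //; rewrite /star_leaf.
  have := tc u; have := td u; have := t3 u.
  by case: (star_type u) => [|[|[|[|]]]] //= _ h1 h2; first [by rewrite h1 | by rewrite h2].
have := tc v; have := td v; have := t3 v; rewrite /star_leaf.
by case: (star_type v) => [|[|[|[|]]]] //= _ h1 h2; first [by rewrite h1 | by rewrite h2].
Qed.

Let star_walk u v :
  exists p, [/\ path O u p, last u p = v & 0 < size p <= 4].
Proof.
case: u v => [[u x] i] [[v y] j].
have [[k [k6 ku]] [l [l6 lv]]] := star_leaf_cover u v.
pose h (w : nat * nat * bool) : GC * bool :=
  ((star_leaf u v w.1.1, inord w.1.2), w.2).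
have h_arc w1 w2 : model_arc w1 w2 -> O (h w1) (h w2).
  case: w1 w2 => [[k1 x1] i1] [[k2 x2] i2] /andP[e12 s12].
  rewrite OE cart_edgeE /triple /= !star_leaf_type.
  case/orP: e12 => [/andP[/eqP k12 /and3P[x12 x13 x23]]|/andP[k12 /eqP x12]].
    rewrite !inordK // s12 andbT k12 eqxx /=; apply/orP; left.
    rewrite /cycle_edge /= -!val_eqE /= !inordK // x12.
    by move: x1 x2 x12 x13 x23 {s12} => [|[|[|]]] // [|[|[|]]].
  (* No bound on x1 is available here, so [inord x1] may have another value; between different types
     [star_arc] ignores the triangle vertex. *)
  have t12 : leaf_type k1 == leaf_type k2 = false.
    by case/orP: k12 => /eqP <-; rewrite ?(eq_sym _.+1) -[X in X == _]addn0 -addn1 eqn_add2l.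
  move: s12; rewrite /star_arc t12 => ->; rewrite andbT x12 eqxx andbT; apply/orP; right.
  case/orP: k12 => /eqP k12; last rewrite edge_sym.
    by apply: star_type_succ; rewrite !star_leaf_type.
  by apply: star_type_succ; rewrite !star_leaf_type.
have inV m z i' : m < 6 -> (m, val (z : 'I_3), i') \in model_vertices.
  move=> m6; apply: (allpairs_f pair); last by case: i'.
  by apply: (allpairs_f pair); rewrite mem_iota ?ltn_ord.
have [p [ep lp sp]] := model_walk (inV k x i k6) (inV l y j l6).
have hu : h (k, val x, i) = ((u, x), i) by rewrite /h /= ku inord_val.
have hv : h (l, val y, j) = ((v, y), j) by rewrite /h /= lv inord_val.
exists (map h p); rewrite -hu -hv last_map lp size_map; split=> //.
exact: homo_path ep.
Qed.

Lemma double_star_in_C0 (s : GC -> nat) :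
  gdiam G = 3 -> (forall v, 2 <= s v) -> in_C0 GC s.
Proof.
move=> dG s2; have cG := proj1 G_tree; have cC := @cycle_connected 3 isT.
apply: (double_in_C0 (cart_connected cG cC) s2 O_orient) => u v.
have [p [Op lp /andP[p0 p4]]] := star_walk u v.
exists p; rewrite p0; split=> //; apply: leq_trans p4 _.
apply: leq_trans (cart_gdiam cG cC); rewrite dG.
by rewrite addSn !ltnS (@gdiam_gt0 (cycle_graph 3) ord0 ord_max).
Qed.

End DoubleStar.

Theorem theorem1p10 (lambda mu : nat) (T : sgraph)
    (hT : tree T) (hdiam : gdiam T = lambda)
    (hlm : (2 <= lambda /\ 4 <= mu) \/ (lambda = 3 /\ mu = 3))
    (s : cart_prod T (cycle_graph mu) -> nat)
    (hs : forall v : cart_prod T (cycle_graph mu), 2 <= s v) :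
  in_C0 (cart_prod T (cycle_graph mu)) s.
Proof.
case: hlm => [[l2 mu4]|[l3 mu3]].
  have [col colP] := tree_bipartite hT.
  apply: (bipartite_cart_in_C0 colP) => //; first by case: hT.
  - exact/cycle_connected/(leq_trans _ mu4).
  - by rewrite hdiam.
  - exact: cycle_gdiam_ge2.
subst mu; rewrite {}l3 in hdiam.
have [a [b [c [d [ac cd db [ad bc] star]]]]] := double_star hT hdiam.
exact: (double_star_in_C0 hT ac cd db ad bc star hdiam hs).
Qed.
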